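(* Let $x$ be an indeterminate and let $$\sigma_{n}=\binom{n+1}{2}-\frac{x^{2}-1}{4}\quad(n\ge 0),\qquad \tau_{n}=\frac{n^{4}(x^{2}-n^{2})}{4(2n+1)(2n-1)}\quad(n\ge1).$$ Then, as formal power series in $z$ (with coefficients in $\mathbb{Q}[x]$), $$\sum_{k=0}^{\infty}B_{2k+1}\!\left(\tfrac{x+1}{2}\right)z^{2k} =\cfrac{\tfrac{x}{2}}{1+\sigma_0z^2+\cfrac{\tau_1z^4}{1+\sigma_1z^2+\cfrac{\tau_2z^4}{1+\sigma_2z^2+\ddots}}},$$ where $B_m(\cdot)$ is the $m$th Bernoulli polynomial.
   Context: The Bernoulli polynomials are defined by $\frac{te^{xt}}{e^t-1}=\sum_{n\ge 0}B_n(x)\frac{t^n}{n!}$. The infinite continued fraction is understood as a formal power series: it is the limit, in the usual ($z$-adic) topology on formal power series, of its finite truncations, obtained by terminating the fraction at the denominator $1+\sigma_N z^2$ and letting $N\to\infty$. *)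

(* Defs.v *)
From HB Require Import structures.
From mathcomp Require Import all_boot all_order all_algebra.
From mathcomp Require Import boolp.

Set Implicit Arguments.
Unset Strict Implicit.
Unset Printing Implicit Defensive.

Import GRing.Theory.
Local Open Scope ring_scope.

(* Formal power series over R, given by their coefficient sequences; [f n] is
   the coefficient of the n-th power of the variable. *)
Record fps (R : Type) := Fps { fps_coef :> nat -> R }.

HB.instance Definition _ (R : Type) := gen_eqMixin (fps R).
HB.instance Definition _ (R : Type) := gen_choiceMixin (fps R).

Lemma fpsP (R : Type) (f g : fps R) : (forall n, f n = g n) -> f = g.
Proof. by case: f g => [f] [g] /= fg; congr Fps; apply/funext. Qed.

Section FpsRing.
Variable R : comUnitRingType.
Implicit Types (f g h : fps R) (c : R).

Definition fps_zero : fps R := Fps (fun=> 0).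
Definition fps_opp f : fps R := Fps (fun n => - f n).
Definition fps_add f g : fps R := Fps (fun n => f n + g n).

Lemma fps_addA : associative fps_add.
Proof. by move=> f g h; apply: fpsP => n /=; rewrite addrA. Qed.
Lemma fps_addC : commutative fps_add.
Proof. by move=> f g; apply: fpsP => n /=; rewrite addrC. Qed.
Lemma fps_add0 : left_id fps_zero fps_add.
Proof. by move=> f; apply: fpsP => n /=; rewrite add0r. Qed.
Lemma fps_addN : left_inverse fps_zero fps_opp fps_add.
Proof. by move=> f; apply: fpsP => n /=; rewrite addNr. Qed.

HB.instance Definition _ :=
  GRing.isZmodule.Build (fps R) fps_addA fps_addC fps_add0 fps_addN.

Definition fpsC c : fps R := Fps (fun n => if n == 0%N then c else 0).
Definition fps_mul f g : fps R :=
  Fps (fun n => \sum_(i < n.+1) f i * g (n - i)%N).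

Lemma fps_mulC : commutative fps_mul.
Proof.
move=> f g; apply: fpsP => n /=; rewrite (reindex_inj rev_ord_inj) /=.
by apply: eq_bigr => i _; rewrite mulrC subSS subKn // -ltnS.
Qed.

Lemma fps_mul1 : left_id (fpsC 1) fps_mul.
Proof.
move=> f; apply: fpsP => n /=.
rewrite big_ord_recl /= mul1r subn0 big1 ?addr0 // => i _.
by rewrite mul0r.
Qed.

Lemma fps_mulDl : left_distributive fps_mul fps_add.
Proof.
move=> f g h; apply: fpsP => n /=; rewrite -big_split /=.
by apply: eq_bigr => i _; rewrite mulrDl.
Qed.

(* Coefficients up to n of a product are those of a product of polynomials. *)
Definition fps_trunc n f : {poly R} := \poly_(i < n.+1) f i.

Lemma coef_fps_trunc n f i : (i <= n)%N -> (fps_trunc n f)`_i = f i.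
Proof. by move=> le_in; rewrite coef_poly ltnS le_in. Qed.

Lemma fps_mul_trunc n f g (p q : {poly R}) :
    (forall i, (i <= n)%N -> p`_i = f i) ->
    (forall i, (i <= n)%N -> q`_i = g i) ->
  forall i, (i <= n)%N -> (p * q)`_i = fps_mul f g i.
Proof.
move=> pf qg i le_in; rewrite coefM /=; apply: eq_bigr => j _.
rewrite pf ?qg //; last by rewrite (leq_trans _ le_in) // -ltnS.
by rewrite (leq_trans (leq_subr _ _)).
Qed.

Lemma fps_mulA : associative fps_mul.
Proof.
move=> f g h; apply: fpsP => n.
have tr u i : (i <= n)%N -> (fps_trunc n u)`_i = u i by exact: coef_fps_trunc.
rewrite -(fps_mul_trunc (tr f) (fps_mul_trunc (tr g) (tr h))) //.
by rewrite -(fps_mul_trunc (fps_mul_trunc (tr f) (tr g)) (tr h)) // mulrA.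
Qed.

Lemma fps_one_neq0 : fpsC 1 != 0.
Proof.
by apply/eqP => /(congr1 (fun f : fps R => f 0%N)) /= /eqP; rewrite oner_eq0.
Qed.

HB.instance Definition _ := GRing.Zmodule_isComNzRing.Build (fps R)
  fps_mulA fps_mulC fps_mul1 fps_mulDl fps_one_neq0.

Lemma coef_fps0 n : (0 : fps R) n = 0. Proof. by []. Qed.
Lemma coef_fps1 n : (1 : fps R) n = (n == 0%N)%:R.
Proof. by rewrite /= -[n]/(nat_of_ord (Ordinal (ltnSn n))); case: eqP. Qed.
Lemma coef_fpsN f n : (- f) n = - f n. Proof. by []. Qed.
Lemma coef_fpsD f g n : (f + g) n = f n + g n. Proof. by []. Qed.
Lemma coef_fpsB f g n : (f - g) n = f n - g n. Proof. by []. Qed.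
Lemma coef_fpsM f g n : (f * g) n = \sum_(i < n.+1) f i * g (n - i)%N.
Proof. by []. Qed.
Lemma coef_fpsC c n : fpsC c n = if n == 0%N then c else 0. Proof. by []. Qed.

(* The inverse exists iff the constant coefficient is a unit, and is then given
   by the usual recursion on coefficients:
   [fps_inv_coefs f n] lists the coefficients of 1/f of index < n. *)
Fixpoint fps_inv_coefs f n : seq R :=
  if n is n'.+1 then
    let s := fps_inv_coefs f n' in
    rcons s ((f 0%N)^-1 *
      ((n' == 0%N)%:R - \sum_(i < n') f i.+1 * s`_(n' - i.+1)))
  else [::].

Definition fps_unit f : bool := f 0%N \is a GRing.unit.
Definition fps_inv f : fps R :=
  if fps_unit f then Fps (fun n => (fps_inv_coefs f n.+1)`_n) else f.

Lemma size_fps_inv_coefs f n : size (fps_inv_coefs f n) = n.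
Proof. by elim: n => //= n IHn; rewrite size_rcons IHn. Qed.

Lemma nth_fps_inv_coefs f n i :
  (i < n)%N -> (fps_inv_coefs f n)`_i = (fps_inv_coefs f i.+1)`_i.
Proof.
elim: n => // n IHn; rewrite ltnS leq_eqVlt => /predU1P[-> // | lt_in].
by rewrite [LHS]/= nth_rcons size_fps_inv_coefs lt_in IHn.
Qed.

Lemma fps_mulVr : {in fps_unit, left_inverse 1 fps_inv *%R}.
Proof.
move=> f; rewrite -topredE /= => f_unit; rewrite mulrC; apply: fpsP => n.
rewrite coef_fps1 coef_fpsM big_ord_recl subn0 /fps_inv f_unit.
rewrite [X in f ord0 * X]/= nth_rcons size_fps_inv_coefs ltnn eqxx mulVKr //.
set s1 := \sum_(i < n) _; set s2 := \sum_(i < n) _.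
suff -> : s2 = s1 by rewrite subrK.
apply: eq_bigr => i _; congr (_ * _); rewrite /= [RHS]nth_fps_inv_coefs //.
by rewrite ltn_subrL /=; case: (n) i => [[]|].
Qed.

Lemma fps_unitPl f g : g * f = 1 -> fps_unit f.
Proof.
move=> /(congr1 (fun h : fps R => h 0%N)).
rewrite coef_fps1 coef_fpsM big_ord1 /= subnn => gf1.
by apply/unitrPr; exists (g 0%N); rewrite mulrC.
Qed.

Lemma fps_inv_out : {in [predC fps_unit], fps_inv =1 id}.
Proof. by move=> f /negbTE f_unit; rewrite /fps_inv [fps_unit f]f_unit. Qed.

HB.instance Definition _ := GRing.ComNzRing_hasMulInverse.Build (fps R)
  fps_mulVr fps_unitPl fps_inv_out.

Lemma fps_unitE f : (f \is a GRing.unit) = (f 0%N \is a GRing.unit).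
Proof. by []. Qed.

Definition fpsX : fps R := Fps (fun n => (n == 1%N)%:R).

Lemma coef_fpsCM c f n : (fpsC c * f) n = c * f n.
Proof.
rewrite coef_fpsM big_ord_recl /= subn0 big1 ?addr0 // => i _.
by rewrite mul0r.
Qed.

Lemma coef_fpsXM f n : (fpsX * f) n = if n is n'.+1 then f n' else 0.
Proof.
rewrite coef_fpsM big_ord_recl /= mul0r add0r.
case: n => [|n]; first by rewrite big_ord0.
rewrite big_ord_recl /= mul1r subSS subn0 big1 ?addr0 // => i _.
by rewrite mul0r.
Qed.

Lemma coef_fpsXn k n : (fpsX ^+ k) n = (n == k)%:R.
Proof.
elim: k n => [|k IHk] n; first by rewrite expr0 coef_fps1.
by rewrite exprS coef_fpsXM; case: n.
Qed.

(* Quotient by the variable of a series without constant term. *)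
Definition fps_divX f : fps R := Fps (fun n => f n.+1).

Lemma fps_divXK f : f 0%N = 0 -> fpsX * fps_divX f = f.
Proof. by move=> f0; apply: fpsP => -[|n]; rewrite coef_fpsXM ?f0. Qed.

(* [u N] and [l] agree modulo any given power of the variable for N large. *)
Definition adic_cvg (u : nat -> fps R) (l : fps R) : Prop :=
  forall d : nat, exists N0 : nat, forall N : nat, (N0 <= N)%N ->
    forall n : nat, (n < d)%N -> u N n = l n.

End FpsRing.

Arguments fpsX {R}.

(* e^(a t), as a power series in t. *)
Definition fps_exp (a : {poly rat}) : fps {poly rat} :=
  Fps (fun n => (n`!%:R)^-1 *: a ^+ n).

(* t e^(xt) / (e^t - 1), x being the polynomial variable 'X. As e^t - 1 is not
   invertible, the factor t is first cancelled: see bernoulli_egfE. *)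
Definition bernoulli_egf : fps {poly rat} :=
  fps_exp 'X / fps_divX (fps_exp 1 - 1).

Lemma bernoulli_egfE : bernoulli_egf * (fps_exp 1 - 1) = fpsX * fps_exp 'X.
Proof.
have e0 : (fps_exp 1 - 1) 0%N = 0.
  by rewrite coef_fpsB coef_fps1 /= fact0 invr1 scale1r expr0 subrr.
rewrite -[in LHS](fps_divXK e0) mulrCA divrK // fps_unitE /= expr1n subr0.
by rewrite invr1 scale1r unitr1.
Qed.

Definition bernoulli_poly (n : nat) : {poly rat} :=
  n`!%:R *: bernoulli_egf n.

(* \sum_k B_(2k+1)((x+1)/2) z^(2k) *)
Definition odd_bernoulli_series : fps {poly rat} :=
  Fps (fun n => if odd n then 0
                else bernoulli_poly n.+1 \Po (2^-1 *: ('X + 1))).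

Definition sigma (n : nat) : {poly rat} :=
  'C(n.+1, 2)%:R - 4^-1 *: ('X^2 - 1).

Definition tau (n : nat) : {poly rat} :=
  (n%:R ^+ 4 / (4 * (2 * n%:R + 1) * (2 * n%:R - 1))) *: ('X^2 - n%:R ^+ 2).

(* 1 + sigma_n z^2 + tau_(n+1) z^4 / (1 + sigma_(n+1) z^2 + ...), terminated
   at the denominator 1 + sigma_(n+m) z^2. *)
Fixpoint cfrac_denom (n m : nat) : fps {poly rat} :=
  1 + fpsC (sigma n) * fpsX ^+ 2 +
  (if m is m'.+1 then fpsC (tau n.+1) * fpsX ^+ 4 / cfrac_denom n.+1 m' else 0).

Lemma cfrac_denom_unit n m : cfrac_denom n m \is a GRing.unit.
Proof.
rewrite fps_unitE; suff -> : cfrac_denom n m 0%N = 1 by rewrite unitr1.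
have zero k c (f : fps {poly rat}) : (fpsC c * fpsX ^+ k.+1 * f) 0%N = 0.
  by rewrite -mulrA coef_fpsCM exprS -mulrA coef_fpsXM mulr0.
by case: m => [|m]; rewrite /cfrac_denom -/cfrac_denom !coef_fpsD coef_fps1;
  rewrite -[fpsC (sigma n) * _]mulr1 !zero !addr0.
Qed.

Definition cfrac_trunc (N : nat) : fps {poly rat} :=
  fpsC (2^-1 *: 'X) / cfrac_denom 0 N.

(* Main.v *)
Require Import Defs.
From HB Require Import structures.
From mathcomp Require Import all_boot all_algebra.
From mathcomp Require Import ring lra.

(** Put a = (x+1)/2 and let L be the linear form on polynomials in t with
    L(t^k) = B_(2k+1)(a), so that the series to be expanded is the moment
    generating function of L. The fraction is the J-fraction attached to the
    monic polynomials p_n given by p_0 = 1 and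

      p_(n+1) = (t + sigma_n) p_n + tau_n p_(n-1),

    and the classical link between the two (Favard) is that the fraction
    expands the moments of the form L as soon as L(p_n) = 0 for all n >= 1 and
    L(p_0) = x/2: full orthogonality follows from that by the recurrence.

    The link is obtained without any division by tau_n. Let
    K_n = sum_j L(t^j p_n) z^(2j). The recurrence for p_n, together with
    L(p_n) = 0 for n >= 1, says that (1 + sigma_n z^2) K_n + E_n = z^2 K_(n+1)
    with E_n = tau_n z^2 K_(n-1), and E_0 = -x/2. Inserting this equation into
    itself along the fraction gives, for the fraction D with m + 1 levels that
    starts at level n, that D K_n + E_n is divisible by z^(2m+2)
    ([cfrac_denom_second_kind]). For n = 0 this compares x/2 with D K_0,
    where K_0 is the given series.

    It remains to compute L(p_n). The p_n are the Wilson polynomials in t = s^2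
    (up to the usual s -> is) with parameters
    ((x+1)/2, (x+1)/2, (1-x)/2, (1-x)/2); they are

      p_n = sum_k c_(n,k) phi_k,  phi_k = prod_(i<k) ((a+i)^2 - t),

    where c_(n,k) is, up to a factor depending on n only,
    (-1)^k C(n,k) C(n+k,k) / k! prod_(k<=i<n) (x+1+i) ([wilson_poly_rec]).
    The form L is evaluated on phi_k by umbral calculus. Write E for the form
    Y^m |-> B_m(a), so that L(p) = E(Y p(Y^2)); the generating function of the
    Bernoulli polynomials gives E(q(Y+1) - q(Y)) = q'(a). The polynomial
    Y phi_k(Y^2) is, up to the factor -2(k+1), such a difference q(Y+1) - q(Y)
    with q a product of linear factors vanishing at a, whence
    L(phi_k) = x k! prod_(i<k) (x+1+i) / (2(k+1))
    ([odd_umbral_wilson_basis]). Then L(p_n) is a multiple of the sum of the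
    (-1)^k C(n,k) C(n+k,k) / (k+1), that is, of the integral over [0, 1] of the
    n-th shifted Legendre polynomial, which vanishes for n >= 1. *)

Set Implicit Arguments.
Unset Strict Implicit.
Unset Printing Implicit Defensive.

Import GRing.Theory.
Local Open Scope ring_scope.

(** * Umbral calculus *)

Section Umbral.
Variables (R : comNzRingType) (mu : nat -> R).
Implicit Types (p q : {poly R}).

Definition umbral q : R := \sum_(i < size q) q`_i * mu i.

Lemma umbral_wide n q : (size q <= n)%N -> umbral q = \sum_(i < n) q`_i * mu i.
Proof.
move=> le_qn; rewrite /umbral (big_ord_widen n (fun i => q`_i * mu i)) //.
rewrite big_mkcond; apply: eq_bigr => i _; case: ltnP => // le_qi.
by rewrite nth_default ?mul0r.
Qed.

Lemma umbral_is_linear : linear_for *%R umbral.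
Proof.
move=> c p q; pose n := maxn (size p) (size q).
have le_pn : (size p <= n)%N by rewrite leq_maxl.
have le_qn : (size q <= n)%N by rewrite leq_maxr.
rewrite (umbral_wide le_pn) (umbral_wide le_qn) (@umbral_wide n); last first.
  rewrite (leq_trans (size_polyD _ _)) // geq_max le_qn andbT.
  exact: leq_trans (size_scale_leq _ _) le_pn.
rewrite mulr_sumr -big_split; apply: eq_bigr => i _ /=.
by rewrite coefD coefZ mulrDl mulrA.
Qed.

HB.instance Definition _ :=
  GRing.isLinear.Build R {poly R} R *%R umbral umbral_is_linear.

Lemma umbralXn n : umbral 'X^n = mu n.
Proof.
rewrite (@umbral_wide n.+1) ?size_polyXn // big_ord_recr /= coefXn eqxx mul1r.
rewrite big1 ?add0r // => i _.
by rewrite coefXn ltn_eqF ?mul0r.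
Qed.

(** The form p |-> E(Y p(Y^2)), which sees the odd moments only. *)
Definition odd_umbral p : R := umbral ('X * (p \Po 'X^2)).

Lemma odd_umbral_is_linear : linear_for *%R odd_umbral.
Proof.
move=> c p q.
by rewrite /odd_umbral comp_polyD comp_polyZ mulrDr -scalerAr linearP.
Qed.

HB.instance Definition _ :=
  GRing.isLinear.Build R {poly R} R *%R odd_umbral odd_umbral_is_linear.

Variable a : R.
Hypothesis mu_diff : forall n,
  umbral (('X + 1) ^+ n) - umbral 'X^n = a ^+ n.-1 *+ n.

(** The difference equation of the Bernoulli polynomials in umbral form; it
    evaluates the form on any polynomial recognised as a difference. *)
Lemma umbral_diff q : umbral (q \Po ('X + 1)) - umbral q = q^`().[a].
Proof.
rewrite -{1 2 3}[q]coefK poly_def.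
rewrite !(linear_sum umbral, linear_sum (comp_poly _),
  linear_sum (@deriv R)) /= -sumrB horner_sum.
apply: eq_bigr => i _; rewrite derivZ derivXn hornerZ hornerMn hornerXn.
by rewrite comp_polyZ comp_Xn_poly !linearZ -mulrBr mu_diff.
Qed.
End Umbral.

(** * The moment form on a Newton-type basis *)

Definition wilson_basis (R : comNzRingType) (a : R) k : {poly R} :=
  \prod_(i < k) (((a + i%:R) ^+ 2)%:P - 'X).

Lemma wilson_basisS (R : comNzRingType) (a : R) k :
  wilson_basis a k.+1 = wilson_basis a k * (((a + k%:R) ^+ 2)%:P - 'X).
Proof. by rewrite /wilson_basis big_ord_recr. Qed.

Section Moments.
Variables (R : comNzRingType) (mu : nat -> R) (a : R).
Hypothesis mu_diff : forall n,
  umbral mu (('X + 1) ^+ n) - umbral mu 'X^n = a ^+ n.-1 *+ n.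

(** In terms of Y, with t = Y^2, the element phi_k is the product of the
    (a + i - Y)(a + i + Y). Shifting Y by 1 permutes these linear factors up to
    those at both ends, so Y phi_k(Y^2) is a multiple of a difference
    q(Y+1) - q(Y) with q = prod_(i<=k) (a + i - Y)(a - 1 + i + Y); only the
    factor a - Y vanishing at a contributes to q'(a). *)
Lemma odd_umbral_wilson_basis k :
  odd_umbral mu (wilson_basis a k) *+ (2 * k.+1) =
  k`!%:R * \prod_(i < k.+1) (a *+ 2 - 1 + i%:R).
Proof.
pose h m : {poly R} := \prod_(i < m) ((a + i%:R)%:P - 'X).
pose g : {poly R} :=
  h k.+1 * \prod_(i < k.+1) ((a - 1 + i%:R)%:P + 'X).
have gE :
    g \Po ('X + 1) - g = - ('X * (wilson_basis a k \Po 'X^2)) *+ (2 * k.+1).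
  pose h' m : {poly R} := \prod_(i < m) ((a + i%:R)%:P + 'X).
  have -> : wilson_basis a k \Po 'X^2 = h k * h' k.
    rewrite /wilson_basis rmorph_prod /h /h' -big_split /=.
    apply: eq_bigr => i _; rewrite !rmorphB /= comp_polyC comp_polyX.
    by rewrite !polyCD; ring.
  have -> : g \Po ('X + 1) = ((a - 1)%:P - 'X) * h k * h' k.+1.
    rewrite /g rmorphM /= /h /h' !rmorph_prod [X in X * _]big_ord_recl /=.
    congr (_ * _ * _); last first.
    - by apply: eq_bigr => i _; rewrite /= rmorphD /= comp_polyC comp_polyX
        !polyCD polyCN; ring.
    - by apply: eq_bigr => i _; rewrite /= rmorphB /= comp_polyC comp_polyX
        -natr1 !polyCD; ring.
    by rewrite rmorphB /= comp_polyC comp_polyX addr0 polyCB; ring.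
  have -> : g = h k.+1 * (((a - 1)%:P + 'X) * h' k).
    rewrite /g; congr (_ * _); rewrite big_ord_recl addr0; congr (_ * _).
    by apply: eq_bigr => i _; rewrite /= -natr1 !polyCD polyCN; ring.
  rewrite /h /h' !big_ord_recr /= -/(h k) -/(h' k) !polyCD polyCN.
  by rewrite polyC_natr; ring.
(* With g = (a - Y) * G * H, the derivative of g at Y = a is - G(a) H(a). *)
have := umbral_diff mu_diff g.
rewrite -raddfB gE raddfMn raddfN /= -/(odd_umbral _ _).
rewrite mulNrn /g /h big_ord_recl addr0.
set G := (\prod_(i < k) _); set H := (\prod_(i < k.+1) _).
rewrite -mulrA derivM derivB derivC derivX sub0r hornerD !hornerM.
rewrite !hornerE subrr mul0r addr0 /= -mulrA mulN1r => /oppr_inj ->.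
congr (_ * _); last first.
  by rewrite horner_prod; apply: eq_bigr => i _; rewrite !hornerE; ring.
rewrite horner_prod fact_prod natr_prod big_add1 big_mkord.
by apply: eq_bigr => i _; rewrite !hornerE /= addrAC subrr add0r.
Qed.
End Moments.

(** * Moments given by Bernoulli polynomials *)

Lemma natrS_neq0 n : n.+1%:R != 0 :> rat.
Proof. by rewrite Num.Theory.pnatr_eq0. Qed.

Lemma factr_neq0 n : n`!%:R != 0 :> rat.
Proof. by rewrite Num.Theory.pnatr_eq0 -lt0n fact_gt0. Qed.

(** This is B_n(x+1) - B_n(x) = n x^(n-1) with B_n(x+1) expanded around x:
    compare coefficients in (t e^(xt) / (e^t - 1)) (e^t - 1) = t e^(xt). *)
Lemma bernoulli_poly_sum n :
  (\sum_(i < n.+1) bernoulli_poly i *+ 'C(n, i)) - bernoulli_poly n =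
  ('X^(n.-1) : {poly rat}) *+ n.
Proof.
have := congr1 (fun f : fps {poly rat} => n`!%:R *: f n) bernoulli_egfE.
rewrite mulrBr mulr1 coef_fpsB coef_fpsM coef_fpsXM scalerBr scaler_sumr => nE.
transitivity (n`!%:R *: (if n is n'.+1 then fps_exp 'X n' else 0)).
  rewrite -nE; congr (_ - _); apply: eq_bigr => i _ /=.
  rewrite expr1n /bernoulli_poly -scaler_nat scalerA -scalerAr mulr1 scalerA.
  congr (_ *: _); rewrite -(bin_fact (ltnSE (ltn_ord i))) !natrM.
  by field; rewrite factr_neq0.
case: n {nE} => [|n]; first by rewrite scaler0 mulr0n.
by rewrite /= scalerA factS natrM mulfK ?factr_neq0 // scaler_nat.
Qed.

Definition half_succ_X : {poly rat} := 2^-1 *: ('X + 1).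
Definition bernoulli_moment n : {poly rat} := bernoulli_poly n \Po half_succ_X.

Lemma bernoulli_moment_diff n :
  umbral bernoulli_moment (('X + 1) ^+ n) - umbral bernoulli_moment 'X^n =
  half_succ_X ^+ n.-1 *+ n.
Proof.
have := congr1 (comp_poly half_succ_X) (bernoulli_poly_sum n).
rewrite rmorphB rmorphMn /= comp_Xn_poly => <-; congr (_ - _); last first.
  exact: umbralXn.
rewrite addrC exprDn !raddf_sum; apply: eq_bigr => i _.
by rewrite expr1n mul1r !raddfMn /= umbralXn.
Qed.

(** * Wilson polynomials *)

(** The rational factor of the coefficient of phi_k in p_n, normalised so that
    p_n is monic in t: phi_n has leading coefficient (-1)^n. *)
Definition wilson_num n k : rat :=
  (-1) ^+ k * 'C(n, k)%:R * 'C(n + k, k)%:R * n`!%:R ^+ 3 /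
  (k`!%:R * (n.*2)`!%:R).

Lemma wilson_num_stepn n k :
  wilson_num n.+1 k * (n.+1%:R - k%:R) * (2 * n%:R + 1) * 2 =
  wilson_num n k * (n%:R + k%:R + 1) * n.+1%:R ^+ 2.
Proof.
have [lt_kn|] := ltnP n.+1 k.
  rewrite /wilson_num (bin_small lt_kn) (bin_small (ltnW lt_kn)).
  by rewrite !(mulr0, mul0r).
move=> le_kn.
have bin1 : 'C(n.+1, k)%:R * (n.+1%:R - k%:R) = n.+1%:R * 'C(n, k)%:R :> rat.
  by rewrite -natrB // -!natrM mulnC -mul_bin_down.
have bin2 : n.+1%:R * 'C(n.+1 + k, k)%:R =
            (n%:R + k%:R + 1) * 'C(n + k, k)%:R :> rat.
  by rewrite -natrD natr1 -!natrM -addSn (mul_bin_down (n.+1 + k)) addnK.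
have fact2 :
    (n.+1.*2)`!%:R = (n.+1%:R * 2) * (2 * n%:R + 1) * (n.*2)`!%:R :> rat.
  rewrite doubleS !factS !natrM mulrA; congr (_ * _ * _).
    by rewrite -doubleS -muln2 natrM.
  by rewrite -mul2n -natr1 natrM.
transitivity ((-1) ^+ k * ('C(n.+1, k)%:R * (n.+1%:R - k%:R)) *
   (n.+1%:R * 'C(n.+1 + k, k)%:R) * n`!%:R ^+ 3 * n.+1%:R /
  (k`!%:R * (n.*2)`!%:R) : rat).
  rewrite /wilson_num fact2 factS natrM; field.
  by rewrite !factr_neq0 -natrM natr1 nat1r !natrS_neq0.
rewrite bin1 bin2 /wilson_num; field.
by rewrite !factr_neq0.
Qed.

Lemma wilson_num_stepk n k :
  wilson_num n k.+1 * k.+1%:R ^+ 3 =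
  - wilson_num n k * (n%:R - k%:R) * (n%:R + k%:R + 1).
Proof.
have [lt_kn|] := ltnP n k.
  rewrite /wilson_num (bin_small (leqW lt_kn)) (bin_small lt_kn).
  by rewrite !(mulr0, mul0r, oppr0).
move=> le_kn.
have bin1 : k.+1%:R * 'C(n, k.+1)%:R = (n%:R - k%:R) * 'C(n, k)%:R :> rat.
  by rewrite -natrB // -!natrM mul_bin_left.
have bin2 : k.+1%:R * 'C(n + k.+1, k.+1)%:R =
            (n%:R + k%:R + 1) * 'C(n + k, k)%:R :> rat.
  by rewrite -natrD natr1 -!natrM addnS -mul_bin_diag.
transitivity (- (-1) ^+ k * (k.+1%:R * 'C(n, k.+1)%:R) *
   (k.+1%:R * 'C(n + k.+1, k.+1)%:R) * n`!%:R ^+ 3 /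
  (k`!%:R * (n.*2)`!%:R) : rat).
  rewrite /wilson_num factS natrM exprS; field.
  by rewrite !factr_neq0 nat1r natrS_neq0.
rewrite bin1 bin2 /wilson_num; field.
by rewrite !factr_neq0.
Qed.

(** The factor of tau_n other than x^2 - n^2. *)
Definition tau_num n : rat :=
  n%:R ^+ 4 / (4 * (2 * n%:R + 1) * (2 * n%:R - 1)).

(** The recurrence between the coefficients of p_(n+1), p_n and p_(n-1), once
    the common product of the x+1+i is cancelled, is affine in x; these are the
    coefficients of x and of 1. Both hold because the four numbers involved are
    rational multiples of a single one by [wilson_num_stepn] and
    [wilson_num_stepk]. *)
Lemma wilson_num_rec n k : (k <= n)%N ->
  let pred := if k is k'.+1 then wilson_num n k' else 0 in
  wilson_num n.+1 k =
     (k%:R + 2^-1) * wilson_num n k - pred + tau_num n * wilson_num n.-1 k /\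
  n.+1%:R * wilson_num n.+1 k =
     (2^-1 * (n%:R * n.+1%:R + 1) + k%:R * (k%:R + 1)) * wilson_num n k
       - k%:R * pred - n%:R * tau_num n * wilson_num n.-1 k.
Proof.
(* The ratios below divide by n + k, which leaves out n = k = 0. *)
case: n => [|m] le_kn pred.
  by case: k @pred le_kn.
set r := wilson_num m.+1 k; set M : rat := m%:R; set K : rat := k%:R.
have M_ge0 : 0 <= M by rewrite Num.Theory.ler0n.
have K_ge0 : 0 <= K by rewrite Num.Theory.ler0n.
have KleM : K <= M + 1 by rewrite natr1 Num.Theory.ler_nat.
have E1 : wilson_num m.+2 k =
    r * (M + K + 2) * (M + 2) ^+ 2 / ((M + 2 - K) * (2 * M + 3) * 2).
  have := wilson_num_stepn m.+1 k; rewrite -/r -/K -!natr1 -/M => E.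
  transitivity (r * (M + 1 + K + 1) * (M + 1 + 1) ^+ 2 /
      ((M + 2 - K) * (2 * M + 3) * 2)); last by congr (_ / _); ring.
  by rewrite -E; field; rewrite !Num.Theory.lt0r_neq0 //; lra.
have E2 : pred = - (r * K ^+ 3 / ((M + 2 - K) * (M + 1 + K))).
  rewrite /pred /r /K; case: (k) le_kn => [|j] lt_jm /=.
    by rewrite expr0n /= mulr0 mul0r oppr0.
  have J_ge0 : 0 <= j%:R :> rat by rewrite Num.Theory.ler0n.
  have JleM : j%:R <= M by rewrite Num.Theory.ler_nat.
  rewrite wilson_num_stepk -natr1 -/M -natr1.
  by field; rewrite !Num.Theory.lt0r_neq0 //; lra.
have E3 : wilson_num m k = r * (M + 1 - K) * (2 * M + 1) * 2 /
    ((M + 1 + K) * (M + 1) ^+ 2).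
  have := wilson_num_stepn m k; rewrite -/r -/K -!natr1 -/M => ->.
  by field; rewrite !Num.Theory.lt0r_neq0 //; lra.
rewrite /= E1 E2 E3 /tau_num -!natr1 -/M.
by split; field; rewrite !Num.Theory.lt0r_neq0 //; lra.
Qed.

Definition wilson_coef n k : {poly rat} :=
  wilson_num n k *: \prod_(k <= i < n) ('X + 1 + i%:R).

(** The three-term recurrence read on the basis phi_k, where multiplication by t
    acts as t phi_k = (a+k)^2 phi_k - phi_(k+1). The products of the x+1+i on
    the two sides match because x + n, a factor of tau_n, is the factor i = n-1
    missing from the coefficient of p_(n-1). *)
Lemma wilson_coef_rec n k : (k <= n)%N ->
  wilson_coef n.+1 k =
    (sigma n + (half_succ_X + k%:R) ^+ 2) * wilson_coef n k
    - (if k is k'.+1 then wilson_coef n k' else 0)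
    + tau n * wilson_coef n.-1 k.
Proof.
move=> le_kn; have [Ex E1] := wilson_num_rec le_kn; move: Ex E1.
set pred := (if k is _.+1 then _ else _).
pose Q : {poly rat} := \prod_(k <= i < n) ('X + 1 + i%:R).
have -> : wilson_coef n.+1 k = (wilson_num n.+1 k)%:P * (Q * ('X + 1 + n%:R)).
  by rewrite mul_polyC /wilson_coef big_nat_recr.
have -> : (if k is k'.+1 then wilson_coef n k' else 0) =
    pred%:P * (('X + k%:R) * Q).
  rewrite /pred /Q; case: (k) le_kn => [|j] lt_jn; first by rewrite mul0r.
  rewrite mul_polyC /wilson_coef (big_ltn lt_jn) -natr1.
  by rewrite -[_ + _ + j%:R]addrA (addrC 1).
have -> : tau n * wilson_coef n.-1 k =
    (tau_num n * wilson_num n.-1 k)%:P * (('X - n%:R) * Q).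
  rewrite /tau -/(tau_num n) /wilson_coef -!mul_polyC.
  case: n @Q @pred le_kn => [|m] Q pred le_kn.
    by rewrite /tau_num mulr0n expr0n /= !mul0r.
  move: le_kn; rewrite leq_eqVlt => /predU1P[k_eq | le_km] /=.
    by rewrite k_eq /wilson_num bin_small // !(mulr0, mul0r).
  by rewrite /Q big_nat_recr //= (polyCM (tau_num _)); ring.
have -> : wilson_coef n k = (wilson_num n k)%:P * Q by rewrite mul_polyC.
set w := tau_num n * _; set r1 := wilson_num n.+1 k; set r := wilson_num n k.
rewrite -[_ * tau_num n * _]mulrA -/w => Ex E1.
(* The terms in x^2 cancel, since sigma_n has -x^2/4 and (a+k)^2 has x^2/4. *)
have S : sigma n + (half_succ_X + k%:R) ^+ 2 =
    (2^-1 * (n%:R * n.+1%:R + 1) + k%:R * (k%:R + 1))%:P +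
    (k%:R + 2^-1)%:P * 'X.
  have -> : sigma n = (2^-1 * (n%:R * n.+1%:R))%:P - 4^-1 *: ('X^2 - 1).
    rewrite /sigma -polyC_natr; congr (_%:P - _).
    rewrite -natrM mulnC -[X in (_ * X)%N]bin1 (mul_bin_diag n.+1) natrM.
    by rewrite mulKf.
  have -> : 4^-1 = 2^-1 * 2^-1 :> rat by [].
  have h2 : 2 * (2^-1)%:P = 1 :> {poly rat}.
    by rewrite -polyC_natr -polyCM divff.
  rewrite /half_succ_X -!mul_polyC; ring : h2.
transitivity (Q * ((n.+1%:R * r1)%:P + r1%:P * 'X)).
  rewrite -natr1; ring.
rewrite E1 Ex S; ring.
Qed.

Definition wilson_poly n : {poly {poly rat}} :=
  \sum_(k < n.+1) wilson_coef n k *: wilson_basis half_succ_X k.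

Lemma wilson_poly0 : wilson_poly 0 = 1.
Proof.
rewrite /wilson_poly big_ord1 /wilson_basis big_ord0 /wilson_coef big_geq //.
have -> : wilson_num 0 0 = 1 by [].
by rewrite !scale1r.
Qed.

(** At n = 0 the truncated index n.-1 is harmless, as tau_0 = 0. *)
Lemma wilson_poly_rec n :
  wilson_poly n.+1 =
  ('X + (sigma n)%:P) * wilson_poly n + (tau n)%:P * wilson_poly n.-1.
Proof.
set phi := wilson_basis half_succ_X.
have top_coef : wilson_coef n.+1 n.+1 = - wilson_coef n n.
  rewrite /wilson_coef !big_geq // -scaleNr; congr (_ *: _).
  have up := wilson_num_stepn n n; have right := wilson_num_stepk n.+1 n.
  have n3_neq0 : n.+1%:R ^+ 3 != 0 :> rat by rewrite expf_neq0 ?natrS_neq0.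
  apply: (mulIf n3_neq0); rewrite right; apply: (mulIf (natrS_neq0 n.*2)).
  transitivity (- n.+1%:R * (wilson_num n.+1 n * (n.+1%:R - n%:R) *
    (2 * n%:R + 1) * 2)); first by rewrite -mul2n; ring.
  by rewrite up -mul2n; ring.
have -> : wilson_poly n.-1 = \sum_(k < n.+1) wilson_coef n.-1 k *: phi k.
  case: (n) => [|m] //; rewrite big_ord_recr /= {2}/wilson_coef /wilson_num.
  by rewrite bin_small // !(mulr0, mul0r, scale0r) addr0.
rewrite mulrDl.
have -> : 'X * wilson_poly n =
    \sum_(k < n.+1) ((half_succ_X + k%:R) ^+ 2 * wilson_coef n k
      - (if k : nat is k'.+1 then wilson_coef n k' else 0)) *: phi k
    - wilson_coef n n *: phi n.+1.
  have shift : \sum_(k < n.+1) wilson_coef n k *: phi k.+1 =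
      \sum_(k < n.+1)
        (if k : nat is k'.+1 then wilson_coef n k' else 0) *: phi k
      + wilson_coef n n *: phi n.+1.
    rewrite big_ord_recr [in RHS]big_ord_recl /= scale0r add0r.
    by congr (_ + _).
  transitivity (\sum_(k < n.+1)
      ((half_succ_X + k%:R) ^+ 2 * wilson_coef n k) *: phi k -
      \sum_(k < n.+1) wilson_coef n k *: phi k.+1).
    rewrite -sumrB mulr_sumr; apply: eq_bigr => k _.
    by rewrite /phi wilson_basisS -!mul_polyC polyCM; ring.
  rewrite shift opprD addrA -sumrB; congr (_ - _).
  by apply: eq_bigr => k _; rewrite scalerBl.
rewrite /wilson_poly big_ord_recr /= -/phi top_coef scaleNr.
rewrite !mulr_sumr [X in _ = X + _]addrAC [RHS]addrAC -!big_split.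
congr (_ - _).
apply: eq_bigr => k _ /=; rewrite wilson_coef_rec -1?ltnS //.
by rewrite -!mul_polyC; ring.
Qed.

(** * The moments of the Wilson polynomials *)

(** The alternating sum of the C(n,k) C(n+k,k) / (k+1) is Gosper-summable; the
    right-hand side, obtained from the last summand, vanishes at m = n. This is
    the vanishing of the mean of the shifted Legendre polynomial. *)
Lemma legendre_partial_sum n m :
  n%:R * n.+1%:R * \sum_(k < m.+1) wilson_num n k * (k`!%:R / k.+1%:R) =
  wilson_num n m * (m`!%:R / m.+1%:R) * (n%:R - m%:R) * (n.+1%:R + m%:R).
Proof.
elim: m => [|m IHm]; first by rewrite big_ord1; ring.
rewrite big_ord_recr mulrDr IHm /=.
have -> : wilson_num n m * (m`!%:R / m.+1%:R) * (n%:R - m%:R) *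
    (n.+1%:R + m%:R) = - (m`!%:R / m.+1%:R) *
    (- wilson_num n m * (n%:R - m%:R) * (n%:R + m%:R + 1)) by ring.
rewrite -wilson_num_stepk factS natrM; field.
by rewrite -natrD nat1r !natrS_neq0.
Qed.

Lemma odd_umbral_basis k :
  odd_umbral bernoulli_moment (wilson_basis half_succ_X k) =
  (2^-1 * (k`!%:R / k.+1%:R)) *:
    ('X * \prod_(0 <= i < k) ('X + 1 + i%:R)).
Proof.
have := odd_umbral_wilson_basis bernoulli_moment_diff k.
have -> : half_succ_X *+ 2 - 1 = 'X.
  by rewrite -scaler_nat scalerA divff // scale1r addrK.
rewrite -scaler_nat => /(canRL (scalerK _)) ->; last first.
  by rewrite natrM mulf_neq0 ?natrS_neq0.
rewrite big_mkord big_ord_recl addr0.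
rewrite -polyC_natr mul_polyC scalerA natrM; congr (_ *: (_ * _)).
  by field; rewrite nat1r natrS_neq0.
by apply: eq_bigr => i _; rewrite lift0 -natr1 -addrA (addrC 1).
Qed.

Lemma odd_umbral_wilson_poly n :
  odd_umbral bernoulli_moment (wilson_poly n) =
  if n == 0 then 2^-1 *: 'X else 0.
Proof.
case: eqP => [-> | /eqP n_neq0].
  have -> : wilson_poly 0 = wilson_basis half_succ_X 0.
    by rewrite wilson_poly0 /wilson_basis big_ord0.
  by rewrite odd_umbral_basis big_geq // fact0 divr1 !mulr1.
rewrite /wilson_poly linear_sum.
transitivity ((2^-1 * \sum_(k < n.+1) wilson_num n k * (k`!%:R / k.+1%:R)) *:
    ('X * \prod_(0 <= i < n) ('X + 1 + i%:R)) : {poly rat}).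
  rewrite mulr_sumr scaler_suml; apply: eq_bigr => k _.
  rewrite linearZ /= odd_umbral_basis /wilson_coef.
  rewrite [in RHS](@big_cat_nat _ _ _ k) ?ltnS -1?ltnS //=.
  by rewrite -!mul_polyC !polyCM; ring.
have := legendre_partial_sum n n; rewrite subrr mulr0 mul0r => /eqP.
rewrite !mulf_eq0 !Num.Theory.pnatr_eq0 (negbTE n_neq0) /= => /eqP ->.
by rewrite mulr0 scale0r.
Qed.

(** * From vanishing moments to the continued fraction *)

(** The series K_n: up to a power of the variable, the expansion at infinity of
    the function of the second kind attached to p_n. *)
Definition second_kind n : fps {poly rat} :=
  Fps (fun m => if odd m then 0
                else odd_umbral bernoulli_moment ('X^(m./2) * wilson_poly n)).

Lemma second_kind0 : second_kind 0 = odd_bernoulli_series.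
Proof.
apply: fpsP => m /=; case: ifPn => // even_m.
rewrite wilson_poly0 mulr1 /odd_umbral comp_Xn_poly -exprM -exprS umbralXn.
by rewrite mul2n even_halfK.
Qed.

(** The inhomogeneous term of the first equation plays the part of the previous
    function of the second kind. *)
Definition jacobi_prev n : fps {poly rat} :=
  if n is n'.+1 then fpsC (tau n) * fpsX ^+ 2 * second_kind n'
  else - fpsC (2^-1 *: 'X).

(** In positive degree this is the recurrence of the Wilson polynomials. In
    degree 0 it says that L(p_n) = 0 for n >= 1, and for n = 0 that L(p_0) is
    the numerator x/2 of the fraction. *)
Lemma second_kind_rec n :
  (1 + fpsC (sigma n) * fpsX ^+ 2) * second_kind n + jacobi_prev n =
  fpsX ^+ 2 * second_kind n.+1.
Proof.
have shift c f m : (fpsC c * fpsX ^+ 2 * f) m.+2 = c * f m :> {poly rat}.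
  by rewrite -mulrA coef_fpsCM expr2 -mulrA !coef_fpsXM.
have shift_low c f m : (m < 2)%N ->
    (fpsC c * fpsX ^+ 2 * f) m = 0 :> {poly rat}.
  case: m => [|[]] // _; rewrite -mulrA coef_fpsCM expr2 -mulrA !coef_fpsXM;
    exact: mulr0.
have prev0 : jacobi_prev n 0 = - (if n == 0 then 2^-1 *: 'X else 0).
  by case: (n) => [|p] //; rewrite oppr0; exact: shift_low.
have prev1 : jacobi_prev n 1 = 0.
  by case: (n) => [|p]; [exact: oppr0 | exact: shift_low].
have -> : fpsX ^+ 2 * second_kind n.+1 =
  fpsC 1 * fpsX ^+ 2 * second_kind n.+1 by rewrite mul1r.
rewrite mulrDl mul1r; apply: fpsP => -[|[|m]]; rewrite !coef_fpsD.
- rewrite prev0 !shift_low // addr0 [second_kind n 0]/= mul1r.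
  by rewrite odd_umbral_wilson_poly subrr.
- by rewrite prev1 !shift_low // !addr0.
rewrite !shift mul1r.
have -> : jacobi_prev n m.+2 = tau n * second_kind n.-1 m.
  case: (n) => [|p]; last exact: shift.
  by rewrite /= oppr0 /tau mulr0n expr0n !mul0r scale0r mul0r.
have coefE p j : second_kind p j = if odd j then 0 else
    odd_umbral bernoulli_moment ('X^(j./2) * wilson_poly p) by [].
rewrite !coefE; have -> : odd m.+2 = odd m by rewrite /= negbK.
case: ifP => _; first by rewrite !mulr0 !addr0.
rewrite wilson_poly_rec -!linearZ -!linearD /=; congr (odd_umbral _ _).
by rewrite exprS -!mul_polyC; ring.
Qed.

(** If D' denotes the fraction starting one level below, the level added on top
    contributes tau_(n+1) z^4 K_n / D', and tau_(n+1) z^2 K_n is congruent to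
    - D' K_(n+1): so it cancels the term z^2 K_(n+1) up to z^2 times the
    previous remainder. *)
Lemma cfrac_denom_second_kind m n : exists g,
  cfrac_denom n m * second_kind n + jacobi_prev n = fpsX ^+ (m.*2.+2) * g.
Proof.
elim: m n => [|m IHm] n.
  by exists (second_kind n.+1); rewrite /= addr0 second_kind_rec.
have [g gE] := IHm n.+1.
have D_unit := cfrac_denom_unit n.+1 m.
exists (g / cfrac_denom n.+1 m).
have -> : fpsX ^+ m.+1.*2.+2 * (g / cfrac_denom n.+1 m) =
    fpsX ^+ 2 * (cfrac_denom n.+1 m * second_kind n.+1 + jacobi_prev n.+1) /
    cfrac_denom n.+1 m.
  by rewrite gE mulrA (mulrA (fpsX ^+ 2)) -exprD.
rewrite [cfrac_denom n m.+1]/= mulrDl addrAC second_kind_rec.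
rewrite (mulrDr (fpsX ^+ 2)) [RHS]mulrDl (mulrCA (fpsX ^+ 2)).
rewrite [X in _ = X + _]mulrAC divrr // mul1r; congr (_ + _) => /=.
ring.
Qed.

Theorem lemma4p2 : adic_cvg cfrac_trunc odd_bernoulli_series.
Proof.
move=> d; exists d => N le_dN n lt_nd.
have [g gE] := cfrac_denom_second_kind N 0.
have D_unit := cfrac_denom_unit 0 N.
have -> : cfrac_trunc N =
    odd_bernoulli_series - fpsX ^+ N.*2.+2 * (g / cfrac_denom 0 N).
  apply: (mulIr D_unit); rewrite mulrBl divrK // -mulrA divrK // -gE.
  by rewrite second_kind0 mulrC opprD addNKr opprK.
have X_low k (f : fps {poly rat}) : (n < k)%N -> (fpsX ^+ k * f) n = 0.
  move=> lt_nk; rewrite coef_fpsM big1 // => i _.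
  by rewrite coef_fpsXn ltn_eqF ?mul0r // (leq_trans (ltn_ord i)).
rewrite coef_fpsB X_low ?subr0 // -addnn.
by rewrite (leq_trans lt_nd) // (leq_trans le_dN) // !leqW // leq_addr.
Qed.
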